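(* Let $d\ge 2$ be an integer and let $k\in\{2,3,\dots,d\}$. Then the inducibility of the $k$-leaf star $C_k$ in strictly $d$-ary trees is $$i_d(C_k)=\frac{d!}{(d-k)!\,(d^k-d)}.$$ Moreover, for every fixed integer $k\ge 3$, the sequence $\big(i_d(C_k)\big)_{d\ge k}$ is (strictly) increasing in $d$.
   Context: All trees are finite and rooted, with unordered children; isomorphism means isomorphism of rooted trees. The single vertex is regarded as a tree whose only vertex is both root and leaf. For a rooted tree $T$, $|T|$ denotes its number of leaves. For an integer $d\ge 2$, a $d$-ary tree is a rooted tree in which every non-leaf vertex has between $2$ and $d$ children; it is strictly $d$-ary if every non-leaf vertex has exactly $d$ children. (An $n$-leaf strictly $d$-ary tree exists iff $n\ge 1$ and $n\equiv 1 \bmod (d-1)$.) For a nonempty set $S$ of leaves of $T$, the subtree of $T$ induced by $S$ is obtained by taking the minimal subtree of $T$ containing the leaves in $S$, rooting it at the most recent common ancestor of $S$, and suppressing (contracting) all non-root vertices of degree $2$. Let $c(D,T)$ be the number of sets of $|D|$ leaves of $T$ whose induced subtree is isomorphic to $D$, and for $|T|\ge |D|$ let $\gamma(D,T)=c(D,T)/\binom{|T|}{|D|}$. The inducibility of a $d$-ary tree $D$ in strictly $d$-ary trees is $$i_d(D)=\limsup_{n\to\infty}\ \max_{|T|=n,\ T\text{ strictly }d\text{-ary}}\gamma(D,T),$$ where $n$ ranges over integers $n\equiv 1 \bmod (d-1)$. The star $C_k$ is the rooted tree consisting of a root with exactly $k$ children, all of which are leaves. *)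

(* Defs.v *)
From mathcomp Require Import all_boot all_order all_algebra.
From mathcomp Require Import all_classical all_reals all_analysis.

Set Implicit Arguments.
Unset Strict Implicit.
Unset Printing Implicit Defensive.

Import Order.TTheory GRing.Theory Num.Theory.
Import numFieldNormedType.Exports.

Local Open Scope classical_set_scope.
Local Open Scope ring_scope.

(* The order of the children in the list is an artefact of the representation:
   it is ignored by [tree_iso], the only way in which trees are compared.
   [Node [::]] is a leaf; as a whole tree it is the single vertex. *)
Inductive tree : Type := Node of seq tree.

Definition leaf : tree := Node [::].

Definition star (k : nat) : tree := Node (nseq k leaf).

Fixpoint nleaves (T : tree) : nat :=
  let: Node ts := T in if ts is [::] then 1%N else sumn (map nleaves ts).

Fixpoint strictly_ary (d : nat) (T : tree) : bool :=
  let: Node ts := T in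
  nilp ts || (size ts == d) && all (strictly_ary d) ts.

(* Isomorphism of rooted trees with unordered children: the children of the two
   roots are matched one-to-one, matched children being isomorphic. *)
Inductive tree_iso : tree -> tree -> Prop :=
| tree_iso_nil : tree_iso (Node [::]) (Node [::])
| tree_iso_cons (t u : tree) (ts us1 us2 : seq tree) :
    tree_iso t u -> tree_iso (Node ts) (Node (us1 ++ us2)) ->
    tree_iso (Node (t :: ts)) (Node (us1 ++ u :: us2)).

(* The leaves are numbered from left to right; bit number i of the mask [m], of
   length [nleaves T], tells whether leaf number i is selected, and [reshape]
   cuts [m] into the masks of the children.  The result consists of the vertices
   of [T] lying above (or equal to) some selected leaf. *)
Fixpoint prune (T : tree) : bitseq -> tree :=
  let: Node ts := T in fun m =>
  Node [seq f.2 f.1 | f <- zip (reshape (map nleaves ts) m) (map prune ts)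
                    & has id f.1].

(* In a pruned tree, the most recent common ancestor of the selected leaves is
   the first vertex, going down from the root, that does not have exactly one
   child. *)
Fixpoint mrca_subtree (T : tree) : tree :=
  if T is Node [:: t] then mrca_subtree t else T.

(* Contracts all vertices with exactly one child.  A non-root vertex has degree 2
   iff it has exactly one child, and the root of [mrca_subtree T] never has
   exactly one child. *)
Fixpoint suppress (T : tree) : tree :=
  let: Node ts := T in
  if map suppress ts is [:: t] then t else Node (map suppress ts).

Definition induced (T : tree) (S : {set 'I_(nleaves T)}) : tree :=
  suppress (mrca_subtree (prune T [seq i \in S | i <- enum 'I_(nleaves T)])).

Definition copies (D T : tree) : nat :=
  #|[pred S : {set 'I_(nleaves T)} |
      (#|S| == nleaves D) && `[< tree_iso (induced S) D >]]|.

Definition density (R : realType) (D T : tree) : R :=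
  (copies D T)%:R / 'C(nleaves T, nleaves D)%:R.

(* The set under [sup] is finite and nonempty when n = 1 modulo d - 1, so that
   its supremum is a maximum. *)
Definition max_density (R : realType) (d : nat) (D : tree) (n : nat) : R :=
  sup [set density R D T | T in [set T | nleaves T = n /\ strictly_ary d T]].

(* n = m (d - 1) + 1 runs over the positive integers that are 1 modulo d - 1.
   The finitely many terms with n < |D|, where the density is 0 / 0 = 0, do not
   affect the upper limit. *)
Definition inducibility (R : realType) (d : nat) (D : tree) : R :=
  limn_sup (fun m : nat => max_density R d D (m * (d - 1) + 1)%N).

(* Main.v *)
Require Import Defs.
From mathcomp Require Import all_boot all_order all_algebra.
From mathcomp Require Import all_classical all_reals all_analysis.
From mathcomp Require Import ring lra zify.
Import Order.TTheory GRing.Theory Num.Theory.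
Import numFieldNormedType.Exports.
(* Restores the finite-set notations and lemmas shadowed by [classical_sets]. *)
Import mathcomp.boot.finset.
Set Implicit Arguments.
Unset Strict Implicit.
Unset Printing Implicit Defensive.
Local Open Scope ring_scope.

(* A [k]-leaf star arises from [k] selected leaves of [T] either inside a single
   root branch, or by selecting one leaf in each of [k] different branches; hence
   the number [c T] of copies satisfies
     c T = \sum_i c T_i + e_k (|T_1|, ..., |T_d|)
   with [e_k] the elementary symmetric polynomial.  For nonnegative [x_i],
     (d^k - d) e_k <= 'C(d, k) (p_1^k - p_k),
   where [p_j] is the [j]-th power sum, so the recursion gives
   c T <= A (n^k - n) with n = |T| and A = 'C(d, k) / (d^k - d); complete [d]-ary
   trees give equality.  Dividing by 'C(n, k) and letting [n] grow yields A k!.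

   The inequality is a case of Muirhead's: p_1^k - p_k consists of d^k - d
   monomials of degree [k], counted with multiplicity, none of which is a pure
   power.  It is proved by induction on [k] from
   p_1^(k+1) - p_(k+1) = p_1 (p_1^k - p_k) + \sum_i x_i^k e_1 (x without x_i). *)

(** * An inequality between elementary symmetric polynomials and power sums *)

Section ElementarySymmetric.
Variables (R : realFieldType) (I : finType) (x : I -> R).
Hypothesis x_ge0 : forall i, 0 <= x i.

Definition elsym (B : {set I}) (k : nat) : R :=
  \sum_(A : {set I} | (A \subset B) && (#|A| == k)) \prod_(i in A) x i.

Lemma elsym_ge0 B k : 0 <= elsym B k.
Proof. by apply: sumr_ge0 => A _; apply: prodr_ge0. Qed.

Lemma elsym0 B : elsym B 0 = 1.
Proof.
rewrite /elsym (big_pred1 set0) ?big_set0// => A /=.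
by rewrite cards_eq0; case: eqP => [->|]; rewrite ?sub0set ?andbF.
Qed.

Lemma elsymSD1 (B : {set I}) i k : i \in B ->
  elsym B k.+1 = elsym (B :\ i) k.+1 + x i * elsym (B :\ i) k.
Proof.
move=> iB; rewrite /elsym (bigID (fun A : {set I} => i \in A)) /= addrC.
congr (_ + _).
  by apply: eq_bigl => A; rewrite subsetD1 andbAC.
rewrite big_distrr /= (reindex_onto (fun A => i |: A) (fun A => A :\ i)) /=.
  have E A : ((i |: A) :\ i == A) = (i \notin A).
    apply/eqP/idP => [<-|]; [by rewrite setD11 | exact: setU1K].
  apply: eq_big => [A|A].
    rewrite E setU11 andbT subUset sub1set iB subsetD1 cardsU1 /=.
    by case: (i \in A); rewrite ?andbF// !andbT.
  by rewrite E => /andP[_ iA]; rewrite big_setU1.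
by move=> A /andP[_ iA]; rewrite setD1K.
Qed.

(** Double counting: a [k]-element subset [A] of [B] survives the removal of [i] for exactly #|B| -
    k elements [i] of [B]. *)
Lemma sum_elsymD1 (B : {set I}) k :
  \sum_(i in B) elsym (B :\ i) k = (#|B| - k)%:R * elsym B k.
Proof.
rewrite /elsym (exchange_big_dep (fun A : {set I} => (A \subset B) && (#|A| == k))) /=.
  rewrite big_distrr /=; apply: eq_bigr => A /andP[AB /eqP Ak].
  rewrite (eq_bigl (mem (B :\: A))) => [|i].
    by rewrite sumr_const cardsD (setIidPr AB) Ak /= mulr_natl.
  by rewrite /= inE subsetD1 AB Ak eqxx andbT andbC.
move=> i A iB; rewrite subsetD1 => /andP[/andP[-> _] ->] //.
Qed.

Lemma sum_mul_elsymD1 (B : {set I}) k :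
  \sum_(i in B) x i * elsym (B :\ i) k = k.+1%:R * elsym B k.+1.
Proof.
case: (leqP #|B| k) => kB.
  have e0 j (C : {set I}) : (#|C| < j)%N -> elsym C j = 0.
    move=> Cj; rewrite /elsym big1// => A /andP[/subset_leq_card AC /eqP Aj].
    by move: Cj; rewrite -Aj ltnNge AC.
  rewrite e0 // mulr0 big1// => i iB; rewrite e0 ?mulr0//.
  by rewrite (cardsD1 i) iB in kB.
have: \sum_(i in B) elsym B k.+1 = #|B|%:R * elsym B k.+1.
  by rewrite sumr_const mulr_natl.
rewrite (eq_bigr _ (fun i iB => elsymSD1 k iB)) big_split /= sum_elsymD1.
rewrite natrB //; set S := \sum_(_ in _) _; set e := elsym _ _; set c := k.+1%:R; lra.
Qed.

Local Notation d := #|I|.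

(** For 2 <= m <= k, the monomial symmetric polynomial of degree [k] and exponent type (m, 1, ...,
    1). *)
Definition elsym_pow (k m : nat) : R := \sum_i x i ^+ m * elsym [set~ i] (k - m).

Lemma elsym_pow1 k : elsym_pow k.+1 1 = k.+1%:R * elsym setT k.+1.
Proof.
rewrite -sum_mul_elsymD1 /elsym_pow; apply: eq_big => [i|i _]; first by rewrite inE.
by rewrite expr1 subn1 setTD.
Qed.

(* Since (x_i^m - x_j^m)(x_i - x_j) >= 0, summing x_i^m x_j e_(k-m-1) over all i != j
   (with [e] omitting x_i and x_j) only increases when x_i^m x_j becomes x_i^(m+1). *)
Lemma elsym_powS k m : (m < k)%N -> (k <= d)%N ->
  (k - m)%:R * elsym_pow k m <= (d - k + m)%:R * elsym_pow k m.+1.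
Proof.
move=> mk kd.
pose e i j := elsym ([set~ i] :\ j) (k - m.+1).
have eC i j : e i j = e j i by rewrite /e; congr elsym; apply/setP=> z; rewrite !inE andbC.
have -> : (k - m)%:R * elsym_pow k m =
    \sum_i \sum_(j in [set~ i]) x i ^+ m * x j * e i j.
  rewrite big_distrr; apply: eq_bigr => i _ /=.
  rewrite mulrCA -(subnSK mk) -sum_mul_elsymD1 big_distrr; apply: eq_bigr => j _ /=.
  by rewrite mulrA.
have -> : (d - k + m)%:R * elsym_pow k m.+1 =
    \sum_i \sum_(j in [set~ i]) x i ^+ m.+1 * e i j.
  rewrite big_distrr; apply: eq_bigr => i _ /=.
  rewrite mulrCA -big_distrr /= sum_elsymD1 cardsC1; congr (_ * (_%:R * _)).
  move: mk kd; move: d; lia.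
have sw (F : I -> I -> R) : \sum_i \sum_(j in [set~ i]) F i j =
    \sum_i \sum_(j in [set~ i]) F j i.
  rewrite (exchange_big_dep xpredT) //=; apply: eq_bigr => i _; apply: eq_bigl => j.
  by rewrite !inE eq_sym.
(* Symmetrisation: the difference is doubled and [i], [j] trade places in the second copy, so that
   the summands pair up. *)
rewrite -subr_ge0 -(pmulr_rge0 _ (ltr0n R 2)) mulr2n mulrDl mul1r.
rewrite [X in _ <= _ + (X - _)]sw [X in _ <= _ + (_ - X)]sw.
rewrite -!sumrB -big_split; apply: sumr_ge0 => i _ /=.
rewrite -!sumrB -big_split; apply: sumr_ge0 => j _ /=.
rewrite (eC j i).
have -> : x i ^+ m.+1 * e i j - x i ^+ m * x j * e i j +
     (x j ^+ m.+1 * e i j - x j ^+ m * x i * e i j) =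
     (x i ^+ m - x j ^+ m) * (x i - x j) * e i j by rewrite !exprS; ring.
apply: mulr_ge0; last exact: elsym_ge0.
wlog le_ji: i j / x j <= x i => [H|].
  case/orP: (le_total (x j) (x i)) => [/H//|/H].
  by rewrite -(opprB (x i)) -(opprB (x i ^+ m)) mulrNN.
by apply: mulr_ge0; rewrite subr_ge0// lerXn2r// nnegrE.
Qed.

(* [elsym_powS] says that [elsym_pow k m], divided by its number of monomials
   d 'C(d - 1, k - m), is nondecreasing in [m]; for m = 1 it is [k] times [elsym]. *)
Lemma elsym_pow_ge k m : (m < k)%N -> (k <= d)%N ->
  (d * 'C(d.-1, k - m.+1))%:R * elsym setT k <= 'C(d, k)%:R * elsym_pow k m.+1.
Proof.
move=> mk kd; elim: m mk => [|m IH] mk.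
  case: k mk kd => // k _ kd; rewrite elsym_pow1 subn1 /=.
  rewrite mulrA -natrM.
  suff -> : (d * 'C(d.-1, k) = 'C(d, k.+1) * k.+1)%N by [].
  by rewrite mul_bin_diag mulnC.
have {}IH := IH (ltnW mk).
have H := elsym_powS mk kd.
have kd0 : 0 < ((d - k + m.+1)%:R : R) by rewrite ltr0n; lia.
rewrite -(ler_pM2l kd0).
apply: le_trans (_ : ('C(d, k))%:R * ((k - m.+1)%:R * elsym_pow k m.+1) <= _); last first.
  by rewrite [leRHS]mulrCA ler_wpM2l ?ler0n.
rewrite [leRHS]mulrCA; apply: le_trans (ler_wpM2l (ler0n R _) IH); rewrite !mulrA.
rewrite ler_wpM2r ?elsym_ge0// -!natrM ler_nat.
rewrite !mulnA ![(_ * d)%N]mulnC -!mulnA leq_mul2l; apply/orP; right.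
have -> : (k - m.+1 = (k - m.+2).+1)%N by lia.
rewrite mul_bin_left leq_mul2r; apply/orP; right; lia.
Qed.

Lemma elsym1 : elsym setT 1 = \sum_i x i.
Proof.
have := elsym_pow1 0; rewrite mul1r => <-; apply: eq_bigr => i _.
by rewrite expr1 elsym0 mulr1.
Qed.

(** In x_i e_(k+1) the variable x_i is either new, which produces each squarefree monomial k + 2
    times, or already present, which produces a square. *)
Lemma sum_mul_elsym k : (\sum_i x i) * elsym setT k.+1 =
  k.+2%:R * elsym setT k.+2 + elsym_pow k.+2 2.
Proof.
rewrite -sum_mul_elsymD1 /elsym_pow [X in X + _](eq_bigl xpredT) => [|i]; last by rewrite inE.
rewrite -big_split mulr_suml; apply: eq_bigr => i _ /=.
by rewrite (elsymSD1 _ (in_setT i)) subn2 /= setTD mulrDr mulrA.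
Qed.

Lemma sum_expr_elsym_pow k : (\sum_i x i) * (\sum_i x i ^+ k.+1) =
  \sum_i x i ^+ k.+2 + elsym_pow k.+2 k.+1.
Proof.
rewrite mulr_sumr -big_split; apply: eq_bigr => i _ /=.
rewrite subSnn.
rewrite -elsym1 (elsymSD1 _ (in_setT i)) setTD elsym0 mulr1 [x i ^+ k.+2]exprS; ring.
Qed.

Lemma elsym_le k : (0 < k <= d)%N ->
  (d%:R ^+ k - d%:R) * elsym setT k <=
    'C(d, k)%:R * ((\sum_i x i) ^+ k - \sum_i x i ^+ k).
Proof.
case: k => // k; elim: k => [|k IH] kd.
  rewrite !expr1 (eq_bigr x) ?subrr ?mulr0 ?mul0r // => i _; exact: expr1.
have {}IH := IH (ltnW kd).
set s := \sum_i x i in IH *; have s0 : 0 <= s by exact: sumr_ge0.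
have C0 : 0 < ('C(d, k.+1)%:R : R) by rewrite ltr0n bin_gt0 ltnW.
have -> : s ^+ k.+2 - \sum_i x i ^+ k.+2 =
    s * (s ^+ k.+1 - \sum_i x i ^+ k.+1) + elsym_pow k.+2 k.+1.
  by rewrite mulrBr sum_expr_elsym_pow exprS; ring.
have H1 : (d * d.-1)%:R * elsym setT k.+2 <= 'C(d, k.+2)%:R * elsym_pow k.+2 k.+1.
  by have := @elsym_pow_ge k.+2 k (ltnW (ltnSn _)) kd; rewrite subSnn bin1.
(* Of the two parts of s e_(k+1), the squarefree one is a multiple of e_(k+2) already; only the one
   with a square needs [elsym_pow_ge]. *)
have H2 : (d * 'C(d, k.+1))%:R * elsym setT k.+2 <= 'C(d, k.+2)%:R * (s * elsym setT k.+1).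
  rewrite sum_mul_elsym mulrDr; have H := @elsym_pow_ge k.+2 1 isT kd.
  rewrite -lerBlDl mulrA -natrM -mulrBl; apply: le_trans H.
  rewrite ler_wpM2r ?elsym_ge0// lerBlDl -natrD ler_nat.
  rewrite subn2 /= [('C(d, k.+2) * _)%N]mulnC -mul_bin_diag -mulnDr.
  by rewrite -{2}(prednK (leq_ltn_trans (leq0n k.+1) kd)) binS leq_mul2l addnC leqnn orbT.
rewrite -(ler_pM2l C0).
have d1 : (0 < d)%N by lia.
(* Count of monomials: d (d^(k+1) - d) come from the product with [s], bounded through [H2] and
   [IH], and d (d - 1) are of the form x_i^(k+1) x_j, bounded by [H1]. *)
have -> : d%:R ^+ k.+2 - d%:R = d%:R * (d%:R ^+ k.+1 - d%:R) + (d * d.-1)%:R :> R.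
  by rewrite -subn1 natrM natrB // exprS; ring.
have d0 : 0 <= (d%:R ^+ k.+1 - d%:R : R).
  by rewrite subr_ge0 -natrX ler_nat expnS leq_pmulr // expn_gt0 d1.
have H1' := ler_wpM2l (ltW C0) H1.
have H2' := ler_wpM2l d0 H2.
have H3 := ler_wpM2l (mulr_ge0 (ler0n R 'C(d, k.+2)) s0) IH.
move: H1' H2' H3; rewrite natrM.
set e2 := elsym _ _; set e1 := elsym _ _; set c2 := 'C(d, k.+2)%:R; set c1 := 'C(d, k.+1)%:R.
set D := _ - _; set N := _ - _; set M := elsym_pow _ _; lra.
Qed.
End ElementarySymmetric.

(** * Counting copies of a star *)

Section Copies.
Local Open Scope nat_scope.

(** The automatic principle of a nested inductive type has no hypothesis for the children; the
    [foldr] conjunction supplies one for each child and unfolds along the list. *)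
Lemma tree_seq_ind (P : tree -> Prop) :
  (forall ts, foldr (fun t => and (P t)) True ts -> P (Node ts)) ->
  forall t, P t.
Proof.
move=> H; fix IH 1 => -[ts]; apply: H.
elim: ts => [|t ts IHts]; first exact: I.
by split; [exact: (IH t) | exact: IHts].
Qed.

(** Masks are summed bit by bit, so that a sum over the masks of a tree splits along the cut into
    the masks of its children. *)
Fixpoint msum (n : nat) (f : bitseq -> nat) : nat :=
  if n is n'.+1 then msum n' (f \o cons false) + msum n' (f \o cons true)
  else f [::].

Lemma eq_msum n f g : (forall m, size m = n -> f m = g m) -> msum n f = msum n g.
Proof.
elim: n f g => [|n IH] f g fg /=; first exact: fg.
by congr addn; apply: IH => m mn; apply: fg; rewrite /= mn.
Qed.

Lemma msumD n f g : msum n (fun m => f m + g m) = msum n f + msum n g.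
Proof.
by elim: n f g => [|n IH] f g //=; rewrite /comp !IH addnACA.
Qed.

Lemma msumM n f c : msum n (fun m => f m * c) = msum n f * c.
Proof. by elim: n f => [|n IH] f //=; rewrite /comp !IH mulnDl. Qed.

Lemma msum0 n : msum n (fun=> 0) = 0.
Proof. by elim: n => [|n IH] //=; rewrite /comp IH. Qed.

Lemma msum_add n1 n2 f :
  msum (n1 + n2) f = msum n1 (fun m1 => msum n2 (fun m2 => f (m1 ++ m2))).
Proof. by elim: n1 f => [|n IH] f //=; rewrite !IH. Qed.

Lemma msum_nseq n f :
  msum n f = f (nseq n false) + msum n (fun m => has id m * f m).
Proof.
elim: n f => [|n IH] f /=; first by rewrite mul0n addn0.
rewrite {1}IH /comp /= -addnA; congr (_ + (_ + _)).
by apply: eq_msum => m _; rewrite mul1n.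
Qed.

Lemma sum_tuple_msum n (f : bitseq -> nat) : \sum_(t : n.-tuple bool) f t = msum n f.
Proof.
elim: n f => [|n IH] f /=.
  by rewrite (big_pred1 [tuple]) // => t; rewrite [t]tuple0; apply/esym/eqP.
rewrite (reindex (fun p : bool * n.-tuple bool => [tuple of p.1 :: p.2])) /=; last first.
  exists (fun t : n.+1.-tuple bool => (thead t, [tuple of behead t])).
    by case=> b t _; congr pair; apply: val_inj.
  by move=> t _; rewrite -tuple_eta.
rewrite -(pair_bigA _ (fun b (t : n.-tuple bool) => f (b :: t))) /= big_bool addnC.
by rewrite -!IH.
Qed.

Lemma sum_set_msum n (f : bitseq -> nat) :
  \sum_(S : {set 'I_n}) f [seq i \in S | i <- enum 'I_n] = msum n f.
Proof.
rewrite -sum_tuple_msum (reindex (fun t : n.-tuple bool => [set i | tnth t i])) /=.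
  apply: eq_bigr => t _; congr f; rewrite -[RHS]map_tnth_enum.
  by apply: eq_map => i; rewrite inE.
exists (fun S : {set 'I_n} => [tuple i \in S | i < n]).
  by move=> t _; apply: eq_from_tnth => i; rewrite tnth_mktuple inE.
by move=> S _; apply/setP => i; rewrite inE tnth_mktuple.
Qed.

Definition isleaf (T : tree) : bool := let: Node ts := T in nilp ts.

Definition isstar (k : nat) (T : tree) : bool :=
  let: Node ts := T in (size ts == k) && all isleaf ts.

Lemma isleafE T : isleaf T -> T = leaf.
Proof. by case: T => -[]. Qed.

(** Both trees are taken apart by matching, rather than fixing [b] to be a star, so that induction
    on the derivation goes through. *)
Lemma tree_iso_all_isleaf a b : tree_iso a b ->
  let: Node us := b in let: Node ts := a in
  all isleaf us -> size ts = size us /\ all isleaf ts.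
Proof.
elim=> [|t u ts us1 us2 _ IHt _ IHts] //.
rewrite all_cat /= => /and3P[us1l ul us2l].
rewrite size_cat /= addnS -size_cat.
case: IHts => [|-> ->]; first by rewrite all_cat us1l.
rewrite andbT; split=> //.
by case: t u ul IHt => [ts'] [[|//]] _ /(_ isT)[/size0nil->].
Qed.

Lemma isstarE k T : isstar k T -> T = star k.
Proof.
case: T => ts /= /andP[/eqP <- tsl]; congr Node.
by elim: ts tsl => //= t ts IH /andP[/isleafE -> /IH <-].
Qed.

Lemma tree_iso_star k T : tree_iso T (star k) <-> isstar k T.
Proof.
split.
  case: T => ts /tree_iso_all_isleaf[]; first by elim: k.
  by rewrite size_nseq => /= -> ->; rewrite eqxx.
move/isstarE->; elim: k => [|k IH]; first exact: tree_iso_nil.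
apply: (@tree_iso_cons _ _ _ [::]) => //; exact: tree_iso_nil.
Qed.

(** Contraction itself collapses a chain of one-child vertices descending from the root. *)
Lemma suppress_mrca T : suppress (mrca_subtree T) = suppress T.
Proof.
by elim/tree_seq_ind: T => -[|t [|u ts]] //= [-> _].
Qed.

(* The subtrees induced in those trees of [ts] that contain a selected leaf, the mask
   [m] being cut along [ts]. *)
Fixpoint restrictions (ts : seq tree) (m : bitseq) : seq tree :=
  if ts is t :: ts' then
    let m1 := take (nleaves t) m in
    let l := restrictions ts' (drop (nleaves t) m) in
    if has id m1 then suppress (prune t m1) :: l else l
  else [::].

Lemma suppress_prune ts m : suppress (prune (Node ts) m) =
  if restrictions ts m is [:: t] then t else Node (restrictions ts m).
Proof.
rewrite /=.
set l := map suppress _; suff -> : restrictions ts m = l by [].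
rewrite {}/l; elim: ts m => [|t ts IH] m //=.
by rewrite IH; case: ifP.
Qed.

(** Pruning leaves only selected leaves and contraction removes none. Hence a selection that induces
    a [k]-leaf star has [k] elements. *)
Lemma nleaves_suppress_prune T m : size m = nleaves T -> has id m ->
  nleaves (suppress (prune T m)) = count id m.
Proof.
elim/tree_seq_ind: T m => ts IH m.
case: (boolP (nilp ts)) IH => [/nilP-> _|ts0 IH]; first by case: m => [|[] []].
move=> sm hm; rewrite suppress_prune.
have E : sumn (map nleaves (restrictions ts m)) = count id m.
  have {hm ts0} : size m = sumn (map nleaves ts) by case: ts {IH} ts0 sm.
  elim: ts IH m {sm} => [_ [] //|t ts IHts] /= [IHt /IHts {}IHts] m sm.
  rewrite -[in RHS](cat_take_drop (nleaves t) m) count_cat.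
  have st : size (take (nleaves t) m) = nleaves t by rewrite size_takel // sm leq_addr.
  case: ifP => /= [h1|/negbT]; last rewrite has_count -leqNgt leqn0 => /eqP->.
    by rewrite IHt // IHts // size_drop sm addKn.
  by rewrite IHts // size_drop sm addKn.
move: hm; rewrite has_count -E; case: (restrictions ts m) => [//|t [|u l]] //=.
by rewrite addn0.
Qed.

(* The number of nonempty sets of leaves of [T] whose induced subtree satisfies [P]. *)
Definition nrestr (P : pred tree) (T : tree) : nat :=
  msum (nleaves T) (fun m => has id m * P (suppress (prune T m))).

(** Either the first branch holds no selected leaf and drops out of the list, or its restriction
    becomes the head. *)
Lemma msum_restrictions_cons (Q : pred (seq tree)) t ts :
  msum (sumn (map nleaves (t :: ts))) (fun m => Q (restrictions (t :: ts) m)) =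
  msum (sumn (map nleaves ts)) (fun m => Q (restrictions ts m)) +
  msum (nleaves t) (fun m => has id m *
    msum (sumn (map nleaves ts))
      (fun m' => Q (suppress (prune t m) :: restrictions ts m'))).
Proof.
rewrite /= msum_add msum_nseq; congr addn.
  by apply: eq_msum => m _; rewrite take_size_cat ?drop_size_cat ?size_nseq// has_nseq andbF.
apply: eq_msum => m sm; case: (boolP (has id m)) => //= hm; rewrite !mul1n.
by apply: eq_msum => m' _; rewrite take_size_cat // drop_size_cat // hm.
Qed.

Lemma msum_restrictions_nil ts :
  msum (sumn (map nleaves ts)) (fun m => nilp (restrictions ts m)) = 1.
Proof.
elim: ts => // t ts IH; rewrite msum_restrictions_cons IH /= -[RHS]addn0; congr addn.
rewrite -[RHS](msum0 (nleaves t)); apply: eq_msum => m _.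
by rewrite (msum0 (sumn (map nleaves ts))) muln0.
Qed.

(** One branch carries the whole selection; the empty selection in the others is a single choice, by
    [msum_restrictions_nil]. *)
Lemma msum_restrictions_single (P : pred tree) ts :
  msum (sumn (map nleaves ts))
    (fun m => if restrictions ts m is [:: t] then P t : nat else 0) =
  sumn (map (nrestr P) ts).
Proof.
pose Q (l : seq tree) := if l is [:: t] then P t else false.
have E ts' : msum (sumn (map nleaves ts'))
    (fun m => if restrictions ts' m is [:: t] then P t : nat else 0) =
    msum (sumn (map nleaves ts')) (fun m => Q (restrictions ts' m)).
  by apply: eq_msum => m _; case: restrictions => [|? []].
rewrite E; elim: ts => // t ts IH; rewrite msum_restrictions_cons IH /= addnC; congr addn.
apply: eq_msum => m _; congr muln.
rewrite -[RHS]mul1n -(msum_restrictions_nil ts) -msumM.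
by apply: eq_msum => m' _; case: restrictions => //=; rewrite ?mul1n.
Qed.

(** Elementary symmetric polynomial of a list, with the recursion of [msum_restrictions_cons]. *)
Fixpoint elsymn (s : seq nat) (k : nat) : nat :=
  match k, s with
  | 0, _ => 1
  | _.+1, [::] => 0
  | k'.+1, a :: s' => elsymn s' k + a * elsymn s' k'
  end.

Lemma msum_restrictions_leaves ts k :
  msum (sumn (map nleaves ts))
    (fun m => (size (restrictions ts m) == k) && all isleaf (restrictions ts m)) =
  elsymn (map (nrestr isleaf) ts) k.
Proof.
elim: ts k => [|t ts IH] [|k] //.
  rewrite [RHS]/= -(msum_restrictions_nil (t :: ts)); apply: eq_msum => m _.
  by case: restrictions.
rewrite (msum_restrictions_cons (fun l => (size l == k.+1) && all isleaf l)).
rewrite IH [RHS]/=; congr addn; rewrite -IH -msumM; apply: eq_msum => m _.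
rewrite -mulnA; congr muln; rewrite mulnC -msumM; apply: eq_msum => m' _ /=.
by rewrite eqSS mulnb andbCA andbC.
Qed.

Lemma nilp_restrictions ts m : size m = sumn (map nleaves ts) ->
  nilp (restrictions ts m) = ~~ has id m.
Proof.
elim: ts m => [|t ts IH] m /= sm; first by case: m sm.
rewrite -[in RHS](cat_take_drop (nleaves t) m) has_cat negb_or.
by case: ifP => //= _; rewrite IH // size_drop sm addKn.
Qed.

Lemma nleaves_Node ts : ~~ nilp ts -> nleaves (Node ts) = sumn (map nleaves ts).
Proof. by case: ts. Qed.

(** A leaf can only be induced through exactly one nonempty branch, so the count is additive over
    the branches, as is [nleaves]. *)
Lemma nrestr_isleaf T : nrestr isleaf T = nleaves T.
Proof.
elim/tree_seq_ind: T => ts IH.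
case: (boolP (nilp ts)) IH => [/nilP->//|ts0 IH].
have E : map (nrestr isleaf) ts = map nleaves ts.
  by elim: ts IH {ts0} => //= t ts IHts [-> /IHts ->].
rewrite [RHS]nleaves_Node // -E -msum_restrictions_single /nrestr nleaves_Node //.
apply: eq_msum => m /nilp_restrictions; rewrite suppress_prune.
by case: (has id m); case: restrictions => [|t [|u l]] //=; rewrite mul1n.
Qed.

Lemma nrestr_isstar ts k : 1 < k -> ~~ nilp ts ->
  nrestr (isstar k) (Node ts) =
  sumn (map (nrestr (isstar k)) ts) + elsymn (map nleaves ts) k.
Proof.
move=> k1 ts0; rewrite -(eq_map nrestr_isleaf) -msum_restrictions_leaves.
rewrite -msum_restrictions_single -msumD /nrestr nleaves_Node //.
apply: eq_msum => m /nilp_restrictions; rewrite suppress_prune.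
(* As k >= 2, a one-element list is never the list of children of the star, so the two counts do not
   overlap. *)
case: k k1 => [|[|k]] // _; case: (has id m).
  by case: restrictions => [|t [|u l]] //=; rewrite ?addn0 mul1n.
by case: restrictions.
Qed.

Lemma nleaves_star k : 1 < k -> nleaves (star k) = k.
Proof.
move=> k1; rewrite nleaves_Node; last by case: k k1.
by rewrite map_nseq sumn_nseq mul1n.
Qed.

Lemma copies_star k T : 1 < k -> copies (star k) T = nrestr (isstar k) T.
Proof.
move=> k1; rewrite /copies -sum1_card big_mkcond -[RHS]sum_set_msum.
apply: eq_bigr => S _; set m := [seq i \in S | i <- enum 'I_(nleaves T)].
have sm : size m = nleaves T by rewrite size_map size_enum_ord.
have cm : count id m = #|S| by rewrite /m count_map cardE -size_filter enumT.
rewrite inE nleaves_star // /Defs.induced suppress_mrca -/m.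
have -> : `[< tree_iso (suppress (prune T m)) (star k) >] =
    isstar k (suppress (prune T m)).
  by apply/asboolP/idP => /tree_iso_star.
(* The empty selection is excluded from [nrestr] by [has id m] and from [copies] by its
   cardinality. *)
case: (boolP (has id m)) => hm; last first.
  move: hm; rewrite has_count -leqNgt leqn0 cm => /eqP ->.
  by case: k k1.
rewrite mul1n; case: (boolP (isstar k _)) => st; last by rewrite andbF.
rewrite andbT -cm -(nleaves_suppress_prune sm hm).
by rewrite (isstarE st) nleaves_star // eqxx.
Qed.

End Copies.

(** * The upper bound on the number of copies *)

Lemma elsym_elsymn (R : realFieldType) (I : finType) (y : I -> nat) (r : seq I) k :
  uniq r -> (elsymn (map y r) k)%:R = elsym (fun i => (y i)%:R : R) [set i in r] k.
Proof.
elim: r k => [|i r IH] [|k]; [by rewrite elsym0| | by rewrite elsym0|].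
  rewrite /elsym big1 //= => A /andP[]; rewrite set_nil finset.subset0 => /eqP->.
  by rewrite cards0.
move=> /= /andP[ir ur]; have iE : i \in [set z in i :: r] by rewrite inE mem_head.
have rE : [set z in i :: r] :\ i = [set z in r].
  by rewrite set_cons finset.setU1K // inE.
by rewrite (elsymSD1 _ _ iE) rE natrD natrM !IH.
Qed.

Lemma sumn_big (s : seq nat) : sumn s = (\sum_(i < size s) nth 0 s i)%N.
Proof. by rewrite sumnE (big_nth 0%N) big_mkord. Qed.

Lemma elsymn_le (R : realFieldType) (s : seq nat) k : (0 < k <= size s)%N ->
  ((size s)%:R ^+ k - (size s)%:R) * (elsymn s k)%:R <=
  'C(size s, k)%:R * ((sumn s)%:R ^+ k - (sumn [seq a ^ k | a <- s])%N%:R) :> R.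
Proof.
move=> ks; have := @elsym_le R 'I_(size s) (fun i => (nth 0%N s i)%:R) (fun _ => ler0n _ _) k.
rewrite card_ord => /(_ ks); rewrite sumn_big natr_sum.
rewrite (sumn_big (map _ _)) size_map natr_sum.
have -> : elsym (fun i : 'I_(size s) => (nth 0%N s i)%:R : R) setT k = (elsymn s k)%:R.
  have E : [set: 'I_(size s)] = [set i in enum 'I_(size s)].
    by apply/setP => i; rewrite !inE mem_enum.
  rewrite E -elsym_elsymn ?enum_uniq //; congr (elsymn _ _)%:R.
  rewrite -[RHS](mkseq_nth 0%N) /mkseq -val_enum_ord -map_comp.
  exact: eq_map.
congr (_ <= _ * (_ - _)); apply: eq_bigr => i _.
by rewrite (nth_map 0%N) // natrX.
Qed.

Definition star_coef (R : realFieldType) (d k : nat) : R := 'C(d, k)%:R / (d%:R ^+ k - d%:R).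

Lemma expn_sub_gt0 (R : realFieldType) d k : (1 < d)%N -> (1 < k)%N ->
  0 < d%:R ^+ k - d%:R :> R.
Proof.
by move=> d1 k1; rewrite subr_gt0 -natrX ltr_nat -{1}(expn1 d) ltn_exp2l.
Qed.

Lemma star_coef_ge0 (R : realFieldType) d k : (1 < d)%N -> (1 < k)%N ->
  0 <= star_coef R d k.
Proof. by move=> d1 k1; rewrite divr_ge0 ?ler0n // ltW // expn_sub_gt0. Qed.

(** With n_i the numbers of leaves of the branches and n their sum, the branches contribute at most
    A (sum n_i^k - n) by induction and the root at most A (n^k - sum n_i^k); the power sums
    cancel. *)
Lemma copies_star_le (R : realFieldType) d k T : (1 < k <= d)%N -> strictly_ary d T ->
  (copies (star k) T)%:R <= star_coef R d k * ((nleaves T)%:R ^+ k - (nleaves T)%:R).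
Proof.
move=> /andP[k1 kd]; have d1 := leq_trans k1 kd; rewrite copies_star //.
have D0 := expn_sub_gt0 R d1 k1; have A0 := star_coef_ge0 R d1 k1.
elim/tree_seq_ind: T => ts IH.
case: (boolP (nilp ts)) IH => [/nilP-> _ _|ts0 IH].
  by rewrite /= expr1n subrr mulr0; case: k k1 {kd D0 A0} => [|[]].
rewrite [strictly_ary _ _]/= (negbTE ts0) orFb => /andP[/eqP sz ad].
rewrite nrestr_isstar // nleaves_Node // natrD.
have H : (sumn (map (nrestr (isstar k)) ts))%:R <=
    star_coef R d k * ((sumn [seq a ^ k | a <- map nleaves ts])%N%:R
      - (sumn (map nleaves ts))%:R).
  elim: ts IH ad {ts0 sz} => [|t ts IHts] /= => [_ _|[IHt /IHts {}IHts]].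
    by rewrite subrr mulr0.
  move=> /andP[/IHt {}IHt /IHts {}IHts].
  rewrite !natrD natrX; lra.
have H2 : (elsymn (map nleaves ts) k)%:R <= star_coef R d k *
    ((sumn (map nleaves ts))%:R ^+ k - (sumn [seq a ^ k | a <- map nleaves ts])%N%:R).
  rewrite /star_coef mulrAC ler_pdivlMr // mulrC.
  by have := @elsymn_le R (map nleaves ts) k; rewrite size_map sz (ltnW k1) kd; apply.
lra.
Qed.

(** * Complete trees attain the bound *)

Fixpoint complete_tree (d h : nat) : tree :=
  if h is h'.+1 then Node (nseq d (complete_tree d h')) else leaf.

Lemma strictly_ary_complete d h : strictly_ary d (complete_tree d h).
Proof.
elim: h => //= h IH; rewrite size_nseq eqxx /= all_nseq IH !orbT //.
Qed.

Lemma nleaves_complete d h : (0 < d)%N -> nleaves (complete_tree d h) = (d ^ h)%N.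
Proof.
move=> d0; elim: h => // h IH; rewrite [complete_tree _ _]/= nleaves_Node; last by case: d d0 {IH}.
by rewrite map_nseq sumn_nseq IH mulnC expnS.
Qed.

Lemma elsymn_nseq d a k : elsymn (nseq d a) k = ('C(d, k) * a ^ k)%N.
Proof.
elim: d k => [|d IH] [|k] /=; rewrite ?bin0 ?bin0n //.
by rewrite !IH binS expnS; ring.
Qed.

(** For [d] branches with [a] leaves each, e_k = 'C(d, k) a^k and p_1^k - p_k = (d^k - d) a^k, so
    the inequality is an equality at every non-leaf vertex. *)
Lemma copies_star_complete (R : realFieldType) d k h : (1 < k)%N -> (1 < d)%N ->
  (copies (star k) (complete_tree d h))%:R =
  star_coef R d k * ((d ^ h)%:R ^+ k - (d ^ h)%:R).
Proof.
move=> k1 d1; rewrite copies_star //; have D0 := expn_sub_gt0 R d1 k1.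
elim: h => [|h IH].
  by rewrite expn0 expr1n subrr mulr0; case: k k1 {D0} => [|[]].
rewrite [complete_tree _ _]/= nrestr_isstar //; last by case: d d1 {IH D0}.
rewrite !map_nseq sumn_nseq elsymn_nseq nleaves_complete ?(ltnW d1) //.
rewrite natrD natrM IH natrM expnS !natrX !natrM exprMn.
rewrite /star_coef natrX; set a := _ ^+ h; field; rewrite ?gt_eqF //.
Qed.

(** * The upper limit *)

(** For large n the supremum of the tail from n on is at most l + e because of [w], and at least l -
    e because that tail contains u (s n) = w (s n). *)
Lemma limn_sup_squeeze (R : realType) (u w : R^nat) (l : R) (s : nat -> nat) :
  (forall n, u n <= w n) -> (w n @[n --> \oo] --> l)%classic ->
  (forall n, n <= s n)%N -> (forall n, u (s n) = w (s n)) -> limn_sup u = l.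
Proof.
move=> uw wl sn us; apply/cvg_lim => //; apply/cvgrPdist_le => /= e e0.
have [N _ HN] := (@cvgrPdist_le _ _ _ _ _ _ _).1 wl e e0.
exists N => // n /= Nn.
have ub : ubound (sdrop u n) (l + e).
  move=> _ [j /= nj <-]; apply: le_trans (uw j) _.
  by have := HN j (leq_trans Nn nj); rewrite /= ler_distl lerBlDr => /andP[].
have h1 : sup (sdrop u n) <= l + e.
  by apply: ge_sup ub; exists (u n); exists n => /=.
have h2 : u (s n) <= sup (sdrop u n).
  by apply: ub_le_sup; [exists (l + e) | exists (s n) => //=].
have := HN (s n) (leq_trans Nn (sn n)); rewrite /= -us !ler_distl !lerBlDr.
by move=> /andP[_ h3]; rewrite h1 (le_trans h3) // lerD2r.
Qed.

Definition density_bound (R : realType) (d k n : nat) : R :=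
  star_coef R d k * (n%:R ^+ k - n%:R) / 'C(n, k)%:R.

Lemma density_star_le (R : realType) d k T : (1 < k <= d)%N -> strictly_ary d T ->
  density R (star k) T <= density_bound R d k (nleaves T).
Proof.
move=> kd sT; rewrite /density nleaves_star; last by case/andP: kd.
by rewrite ler_wpM2r ?invr_ge0 ?ler0n // copies_star_le.
Qed.

Lemma max_density_star_le (R : realType) d k n : (0 < n)%N -> (1 < k <= d)%N ->
  max_density R d (star k) n <= density_bound R d k n.
Proof.
move=> n0 kd; rewrite /max_density; set S := (X in sup X).
have ub : ubound S (density_bound R d k n).
  by move=> _ [T [<- sT] <-]; exact: density_star_le.
case: (pselect (S !=set0)%classic) => [S0|/nonemptyPn ->]; first exact: ge_sup.
case/andP: kd => k1 kd; have d1 := leq_trans k1 kd.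
(* The supremum of the empty set is 0 by convention, so the bound has to be nonnegative. *)
rewrite sup0 divr_ge0 ?ler0n // mulr_ge0 ?star_coef_ge0 // subr_ge0 -natrX ler_nat.
by rewrite -{1}(expn1 n) leq_pexp2l // ltnW.
Qed.

Lemma max_density_star_expn (R : realType) d k h : (1 < k <= d)%N ->
  max_density R d (star k) (d ^ h) = density_bound R d k (d ^ h).
Proof.
move=> kd; case/andP: (kd) => k1 kd'; have d1 := leq_trans k1 kd'.
apply/eqP; rewrite eq_le max_density_star_le ?expn_gt0 ?(ltnW d1) //=.
have -> : density_bound R d k (d ^ h) = density R (star k) (complete_tree d h).
  by rewrite /density copies_star_complete // nleaves_complete ?(ltnW d1) // nleaves_star.
apply: ub_le_sup.
  exists (density_bound R d k (d ^ h)) => _ [T [<- sT] <-]; exact: density_star_le.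
exists (complete_tree d h) => //; split; last exact: strictly_ary_complete.
by rewrite nleaves_complete // ltnW.
Qed.

Lemma ffact_prod (R : realFieldType) n k :
  (n ^_ k)%:R = \prod_(i < k) (n%:R - i%:R) :> R.
Proof.
elim: k => [|k IH]; first by rewrite big_ord0.
rewrite big_ord_recr /= -IH ffactnSr natrM; case: (leqP k n) => kn.
  by rewrite natrB.
(* For n < k the factor n ^_ k is 0 and absorbs the truncated difference n - k. *)
by rewrite ffact_small ?mul0r.
Qed.

(* Both sides vanish when n + 1 < k, their denominators being 0. *)
Lemma density_bound_harmonic (R : realType) d k n : (1 < k)%N ->
  density_bound R d k n.+1 = star_coef R d k * k`!%:R *
    (1 - harmonic n ^+ k.-1) * (\prod_(i < k) (1 - i%:R * harmonic n))^-1.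
Proof.
move=> k1; rewrite /density_bound /harmonic /=.
set x : R := n.+1%:R; have x0 : x != 0 by rewrite pnatr_eq0.
have kf : k`!%:R != 0 :> R by rewrite pnatr_eq0 -lt0n fact_gt0.
have -> : 'C(n.+1, k)%:R = x ^+ k * \prod_(i < k) (1 - i%:R * x^-1) / k`!%:R.
  apply: (mulIf kf); rewrite mulfVK // -natrM bin_ffact ffact_prod.
  rewrite -[X in x ^+ X]card_ord -prodr_const -big_split; apply: eq_bigr => i _ /=.
  by rewrite mulrBr mulr1 mulrCA mulfV ?mulr1.
rewrite !invfM invrK; set P := (\prod_(i < k) _)^-1.
have -> : x ^+ k - x = x ^+ k * (1 - x^-1 ^+ k.-1).
  case: k k1 {P kf} => // k _ /=; rewrite mulrBr mulr1 exprVn exprSr.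
  by rewrite mulrAC mulfV ?mul1r // expf_neq0.
have : x ^+ k != 0 by rewrite expf_neq0.
by set X := x ^+ k; set H := 1 - _ => X0; field.
Qed.

Lemma cvg_density_bound (R : realType) d k : (1 < k)%N ->
  (density_bound R d k n.+1 @[n --> \oo] --> star_coef R d k * k`!%:R)%classic.
Proof.
move=> k1; under eq_fun do rewrite density_bound_harmonic //.
set c : R := _ * _.
have h0 : (harmonic n @[n --> \oo] --> (0 : R))%classic by exact: cvg_harmonic.
have hX j : (harmonic n ^+ j.+1 @[n --> \oo] --> (0 : R))%classic.
  elim: j => [|j IH]; first exact: h0.
  by under eq_fun do rewrite exprS; have := cvgM h0 IH; rewrite mul0r; exact.
have hP j : (\prod_(i < j) (1 - i%:R * harmonic n) @[n --> \oo] --> (1 : R))%classic.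
  elim: j => [|j IH]; first by under eq_fun do rewrite big_ord0; exact: cvg_cst.
  under eq_fun do rewrite big_ord_recr /=.
  have := cvgM IH (cvgB (cvg_cst (1 : R)) (cvgM (cvg_cst (j%:R : R)) h0)).
  by rewrite mulr0 subr0 mulr1; exact.
have hk : (harmonic n ^+ k.-1 @[n --> \oo] --> (0 : R))%classic.
  by case: k k1 {c} => [|[|k]] // _; exact: hX.
have := cvgM (cvgM (cvg_cst c) (cvgB (cvg_cst (1 : R)) hk)) (cvgV (oner_neq0 R) (hP k)).
by rewrite subr0 invr1 !mulr1; exact.
Qed.

Lemma inducibility_star (R : realType) d k : (1 < k <= d)%N ->
  inducibility R d (star k) = star_coef R d k * k`!%:R.
Proof.
move=> kd; case/andP: (kd) => k1 kd'; have d1 := leq_trans k1 kd'.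
(* For m = 1 + d + ... + d^(h-1) the number of leaves m (d - 1) + 1 is d^h, that of a complete tree,
   where the bound is attained. *)
apply: (@limn_sup_squeeze _ _ (fun m => density_bound R d k (m * (d - 1) + 1)%N) _
  (fun h => \sum_(i < h) d ^ i)%N).
- by move=> n; apply: max_density_star_le; rewrite ?addn1.
- under eq_fun do rewrite addn1.
  apply: (@cvg_comp _ _ _ (muln^~ (d - 1)%N) (fun n => density_bound R d k n.+1)).
    by apply: cvg_mulnr; rewrite subn_gt0.
  exact: cvg_density_bound.
- move=> n; rewrite -[X in (X <= _)%N]card_ord -sum1_card; apply: leq_sum => i _.
  by rewrite expn_gt0 ltnW.
- move=> h; have -> : ((\sum_(i < h) d ^ i) * (d - 1) + 1 = d ^ h)%N.
    by rewrite mulnC subn1 -predn_exp addn1 prednK // expn_gt0 ltnW.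
  exact: max_density_star_expn.
Qed.

(** * Closed form and monotonicity in d *)

Lemma star_coef_factE (R : realFieldType) d k : (k <= d)%N ->
  star_coef R d k * k`!%:R = d`!%:R / ((d - k)`!%:R * (d%:R ^+ k - d%:R)).
Proof.
move=> kd; rewrite /star_coef -(bin_fact kd) !natrM invfM.
have f0 : (d - k)`!%:R != 0 :> R by rewrite pnatr_eq0 -lt0n fact_gt0.
by rewrite !mulrA mulfK // mulrAC.
Qed.

(** At j = 1 the two sides would be equal, in accordance with i_d(C_2) = 1 for every d. *)
Lemma expn_step_lt j d : (1 < j < d)%N -> ((d - j) * d.+1 ^ j + j < d ^ j.+1)%N.
Proof.
case: j => [|[|j]] //; elim: j => [|j IH] jd.
  by rewrite !expnS expn0; nia.
have {}IH := IH (ltnW jd).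
have X0 : (0 < d.+1 ^ j.+2)%N by rewrite expn_gt0.
move: IH X0; have -> : (d ^ j.+4 = d * d ^ j.+3)%N by rewrite expnS.
have -> : (d.+1 ^ j.+3 = d.+1 * d.+1 ^ j.+2)%N by rewrite expnS.
set X := (d.+1 ^ _)%N; set Y := (d ^ _)%N; move: X Y => X Y.
have [e ->] : exists e, d = (e + j.+3)%N by exists (d - j.+3)%N; rewrite subnK // ltnW.
have -> : (e + j.+3 - j.+2 = e.+1)%N by lia.
have -> : (e + j.+3 - j.+3 = e)%N by lia.
(* After multiplication by d = e + j + 3, the identity d (e + 1) - e (d + 1) = j + 3 leaves a
   surplus (j + 3) X, which covers the additive constant as X > 0. *)
move=> IH X0; have := leq_mul (leqnn (e + j.+3)) IH; nia.
Qed.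

(* Cancelling common factors, this is [expn_step_lt] with j = k - 1. *)
Lemma star_coef_lt (R : realFieldType) d k : (2 < k <= d)%N ->
  star_coef R d k < star_coef R d.+1 k.
Proof.
move=> /andP[k2 kd].
have k1 := ltnW k2; have d1 := leq_trans k1 kd.
have D0 := expn_sub_gt0 R d1 k1; have D1 := expn_sub_gt0 R (leqW d1) k1.
rewrite /star_coef ltr_pdivrMr // mulrAC ltr_pdivlMr //.
case: k k2 kd {k1} D0 D1 => [|j] // j1 jd _ _.
(* The factor d + 1 turns 'C(d, j + 1) into (d - j) 'C(d + 1, j + 1), so that the binomial
   cancels. *)
rewrite -(ltr_pM2l (ltr0Sn R d)) !mulrA -natrM.
have := mul_bin_down d.+1 j.+1; rewrite subSS /= => ->.
have C0 : (0 < 'C(d.+1, j.+1))%N by rewrite bin_gt0 ltnW.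
have := @expn_step_lt j d; rewrite jd andbT => /(_ j1) H.
have {}H : (d - j)%:R * d.+1%:R ^+ j + j%:R < d%:R ^+ j.+1 :> R.
  by rewrite -!natrX -natrM -natrD ltr_nat.
rewrite natrM -!mulrA [X in X < _]mulrCA [X in _ < X]mulrCA ltr_pM2l ?ltr0n //.
rewrite (_ : d.+1%:R ^+ j.+1 - _ = d.+1%:R * (d.+1%:R ^+ j - 1)); last by rewrite exprS; ring.
rewrite [X in X < _]mulrCA ltr_pM2l ?ltr0n // mulrBr mulr1 {2}natrB ?(ltnW jd) //.
lra.
Qed.

Theorem theorem1 (R : realType) :
  (forall d k : nat, (2 <= d)%N -> (2 <= k <= d)%N ->
     inducibility R d (star k) =
       d`!%:R / ((d - k)`!%:R * (d%:R ^+ k - d%:R))) /\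
  (forall k : nat, (3 <= k)%N ->
     forall d d' : nat, (k <= d)%N -> (d < d')%N ->
       inducibility R d (star k) < inducibility R d' (star k)).
Proof.
split=> [d k _ kd|k k3 d d' kd].
  by rewrite inducibility_star // star_coef_factE //; case/andP: kd.
elim: d' => // n IH; rewrite ltnS leq_eqVlt => /predU1P dn.
have kn : (k <= n)%N by case: dn => [<-//|/ltnW]; exact: leq_trans.
have lt_n : inducibility R n (star k) < inducibility R n.+1 (star k).
  rewrite !inducibility_star ?(ltnW k3) ?(leqW kn) //.
  by rewrite ltr_pM2r ?ltr0n ?fact_gt0 // star_coef_lt ?k3.
by case: dn => [->//|/IH/lt_trans]; apply.
Qed.
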